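(* Let $E\subset\mathbb T$ be a proper interval (arc) of positive length $|E|$ whose complement has nonempty interior, and let $u_E(x,t)=-2\,\mathbf 1_E(x)$. Then: (i) $u_E+u_E^2/2=0$ almost everywhere, and $u_E$ is a nonzero stationary distributional solution of $$(1-\partial_x^2)u_t+\partial_x\Big(u+\frac{u^2}{2}\Big)=0$$ on $\mathbb T\times\mathbb R$ which vanishes on $\omega\times\mathbb R$ for some nonempty open $\omega\subset\mathbb T$; it also satisfies the Duhamel formulation $$u(t)=S(t)u(0)-\frac12\int_0^tS(t-s)(1-\partial_x^2)^{-1}\partial_x\big(u(s)^2\big)\,ds\qquad(t\in\mathbb R).$$ (ii) For every $0\le s<\frac12$, $u_E\in H^s(\mathbb T)$, and there is a constant $C_s$, independent of $E$, with $\|u_E\|_{H^s}^2\le C_s|E|^{1-2s}$. Consequently, for every $0\le s<\frac12$ and every $\delta>0$ there exist a solution $u\in C(\mathbb R;H^s(\mathbb T;\mathbb R))$ of the equation $(1-\partial_x^2)u_t+\partial_x\big(u+\frac{u^2}{2}\big)=0$ with $\|u(0)\|_{H^s}<\delta$ and a nonempty open $\omega\subset\mathbb T$ such that $u=0$ on $\omega\times\mathbb R$ but $u\not\equiv0$.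
   Context: $\mathbb T=\mathbb R/(2\pi\mathbb Z)$; $\mathbf 1_E$ is the indicator function of $E$. $S(t)$ is the solution group of $(1-\partial_x^2)u_t+u_x=0$, i.e. the Fourier multiplier $e^{-ikt/(1+k^2)}$; $(1-\partial_x^2)^{-1}$ is the Fourier multiplier $(1+k^2)^{-1}$, $k\in\mathbb Z$. $\|f\|_{H^s}^2=\sum_k(1+k^2)^s|\widehat f(k)|^2$ up to a fixed normalization constant. *)

(* Defs.v *)
(* [R : realType] is the field of real numbers.                               *)
(* Functions on the torus R/(2 pi Z) are 2pi-periodic functions on R, subsets *)
(* of the torus are 2pi-periodic subsets of R, and integrals over the torus   *)
(* are integrals over [0, 2 pi].  Space-time functions are written [u t x].   *)
From HB Require Import structures.
From mathcomp Require Import all_boot all_order all_algebra.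
From mathcomp Require Import complex.
From mathcomp Require Import all_classical all_reals all_analysis.

Set Implicit Arguments.
Unset Strict Implicit.
Unset Printing Implicit Defensive.

Import Order.TTheory GRing.Theory Num.Theory.
Import numFieldNormedType.Exports.

Local Open Scope classical_set_scope.
Local Open Scope ring_scope.

Section Torus.
Context {R : realType}.

Notation mu := (@lebesgue_measure R).

Definition twopi : R := pi *+ 2.

Definition period_cell : set R := [set` `[0, twopi]].

Definition periodic_set (A : set R) : Prop :=
  forall x, A (x + twopi) <-> A x.

(* The image of an interval under R -> R/(2 pi Z), pulled back to R. *)
Definition is_arc (E : set R) : Prop :=
  exists I : interval R,
    E = [set x | exists k : int, x + k%:~R * twopi \in I].

Definition torus_measure (E : set R) : R :=
  fine (mu (E `&` [set` `[0, twopi[])).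

(* Openness and interior on the torus are those of the periodic lift. *)
Definition admissible_arc (E : set R) : Prop :=
  [/\ is_arc E, 0 < torus_measure E & (~` E)° !=set0].

Definition torus_open (A : set R) : Prop := periodic_set A /\ open A.

Definition in_L2 (f : R -> R) : Prop :=
  [/\ periodic f twopi, measurable_fun setT f &
      mu.-integrable period_cell (fun x => (f x ^+ 2)%:E)].

(* A periodic function or distribution is handled through its sequence of    *)
(* Fourier coefficients.                                                     *)
Definition coeffs := int -> R[i].

(* (1 / 2 pi) * integral of f(x) exp(-ikx) *)
Definition fourier (f : R -> R) : coeffs := fun k =>
  ((twopi^-1 * \int[mu]_(x in period_cell) (f x * cos (k%:~R * x)))
   -i* (twopi^-1 * \int[mu]_(x in period_cell) (f x * sin (k%:~R * x))))%C.

Definition Hs_norm2 (s : R) (c : coeffs) : \bar R :=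
  \esum_(k in [set: int])
    ((1 + k%:~R ^+ 2) `^ s * ComplexField.Normc.normc (c k) ^+ 2)%:E.

Definition Hs_norm (s : R) (c : coeffs) : \bar R := sqrte (Hs_norm2 s c).

(* H^s(T; R), for s >= 0 *)
Definition in_Hs (s : R) (f : R -> R) : Prop :=
  in_L2 f /\ (Hs_norm s (fourier f) < +oo)%E.

Definition in_C_Hs (s : R) (u : R -> R -> R) : Prop :=
  (forall t, in_Hs s (u t)) /\
  (forall t0, Hs_norm s (fourier (fun x => u t x - u t0 x))
                @[t --> t0] --> 0%E).

Definition multiplier (m : int -> R[i]) (c : coeffs) : coeffs :=
  fun k => m k * c k.

Definition cis (theta : R) : R[i] := (cos theta +i* sin theta)%C.

(* The group of (1 - d_x^2) u_t + u_x = 0: multiplier exp(-ikt / (1 + k^2)). *)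
Definition bbm_group (t : R) : coeffs -> coeffs :=
  multiplier (fun k => cis (- (k%:~R * t / (1 + k%:~R ^+ 2)))).

Definition inv_1_sub_dxx : coeffs -> coeffs :=
  multiplier (fun k => (real_complex R) (1 + k%:~R ^+ 2)^-1).

Definition d_x : coeffs -> coeffs :=
  multiplier (fun k => (0 +i* k%:~R)%C).

(* For a <= b: the Riemann integral of F over [a, b] in the Hilbert space    *)
(* H^s is G, i.e. tagged Riemann sums converge to G in norm as the mesh goes *)
(* to 0.                                                                     *)
Definition is_Hs_RInt (s : R) (F : R -> coeffs) (a b : R) (G : coeffs) : Prop :=
  (forall r, a <= r <= b -> (Hs_norm s (F r) < +oo)%E) /\
  forall eps : R, 0 < eps -> exists2 d : R, 0 < d &
    forall (n : nat) (p tau : nat -> R),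
      p 0%N = a -> p n = b ->
      (forall j, (j < n)%N -> p j <= tau j <= p j.+1 /\ p j.+1 - p j < d) ->
      (Hs_norm s (fun k =>
         (\sum_(j < n) (real_complex R) (p j.+1 - p j) * F (tau j) k) - G k)%R
       < eps%:E)%E.

Definition Hs_integral (s : R) (F : R -> coeffs) (a b : R) (G : coeffs) : Prop :=
  if a <= b then is_Hs_RInt s F a b G
  else is_Hs_RInt s F b a (fun k => - G k).

(* u(t) = S(t) u(0) - 1/2 int_0^t S(t-r) (1 - d_x^2)^-1 d_x (u(r)^2) dr in    *)
(* H^s; equality in H^s is equality of all Fourier coefficients.             *)
Definition duhamel_solution (s : R) (u : R -> R -> R) : Prop :=
  (forall t, in_Hs s (u t)) /\
  forall t, exists2 G : coeffs,
    Hs_integral s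
      (fun r => bbm_group (t - r)
                  (inv_1_sub_dxx (d_x (fourier (fun x => u r x ^+ 2)))))
      0 t G
    & forall k, fourier (u t) k
                = bbm_group t (fourier (u 0)) k - 2%:R^-1 * G k.

Definition partial_t (phi : R -> R -> R) : R -> R -> R :=
  fun t x => derive1 (phi ^~ x) t.

Definition partial_x (phi : R -> R -> R) : R -> R -> R :=
  fun t x => derive1 (phi t) x.

Definition iter_partial (w : seq bool) (phi : R -> R -> R) : R -> R -> R :=
  foldr (fun b psi => if b then partial_t psi else partial_x psi) phi w.

(* C^infinity: all iterated partial derivatives exist and are jointly        *)
(* continuous.                                                               *)
Definition smooth (phi : R -> R -> R) : Prop :=
  forall w : seq bool, let psi := iter_partial w phi in
    (forall t x, derivable (psi ^~ x) t 1 /\ derivable (psi t) x 1) /\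
    continuous (fun z : R * R => psi z.1 z.2).

(* C_c^infinity(T x R) *)
Definition test_function (phi : R -> R -> R) : Prop :=
  [/\ smooth phi, (forall t, periodic (phi t) twopi) &
      exists A : R, forall t x, A < `|t| -> phi t x = 0].

(* (1 - d_x^2) u_t + d_x (u + u^2/2) = 0 in D'(T x R), for u in              *)
(* L^2_loc(T x R): both time and space derivatives are moved to the test     *)
(* function, and the resulting common factor -1 is dropped.                  *)
Definition distributional_solution (u : R -> R -> R) : Prop :=
  [/\ (forall t, periodic (u t) twopi),
      measurable_fun setT (fun z : R * R => u z.1 z.2),
      (forall A : R, (mu \x mu)%E.-integrable ([set` `[- A, A]] `*` period_cell)
         (fun z => (u z.1 z.2 ^+ 2)%:E))
    & forall phi, test_function phi ->
        let v := partial_t phi in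
        \int[(mu \x mu)%E]_(z in setT `*` period_cell)
          (u z.1 z.2 * (v z.1 z.2 - partial_x (partial_x v) z.1 z.2)
           + (u z.1 z.2 + u z.1 z.2 ^+ 2 / 2%:R) * partial_x phi z.1 z.2) = 0].

Definition nonzero (f : R -> R) : Prop := ~ {ae mu, forall x, f x = 0}.

Definition vanishes_on (w : set R) (u : R -> R -> R) : Prop :=
  forall t x, w x -> u t x = 0.

Definition arc_profile (E : set R) : R -> R := fun x => - 2%:R * \1_E x.

End Torus.

(* Main.v *)
(* On the arc [u + u^2/2 = -2 + 2 = 0], and off it [u = 0], so [-2 1_E] is    *)
(* stationary.  The Duhamel integrand is the time derivative of              *)
(* [r |-> -2 c_k exp(-i lam_k (t - r))] with [lam_k = k / (1 + k^2)]          *)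
(* bounded, which makes the Riemann sums converge uniformly in [k] relative   *)
(* to [|c_k|].  The Fourier coefficients of [1_E] are bounded both by [|E|]   *)
(* and by [1/|k|]; splitting the Sobolev sum at [|k| ~ 1/|E|] gives           *)
(* [|E|^(1-2s)], which tends to 0 with the length of the arc.                 *)
Require Import Defs.
From HB Require Import structures.
From mathcomp Require Import all_boot all_order all_algebra.
From mathcomp Require Import complex ring lra.
From mathcomp Require Import all_classical all_reals all_analysis measurable_realfun.

Set Implicit Arguments.
Unset Strict Implicit.
Unset Printing Implicit Defensive.

Import Order.TTheory GRing.Theory Num.Theory.
Import numFieldNormedType.Exports.

Local Open Scope classical_set_scope.
Local Open Scope ring_scope.

(** The polynomial u + u^2/2 vanishes at 0 and at -2, so a function with only these two values makes
    the flux zero pointwise ([arc_profile_root]), and constancy in time removes the other term. Such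
    a function may live on a short arc, because jumps are allowed below H^(1/2).

    Weak form: only f(x) (v - v_xx) with v = phi_t is left, and at each fixed x the time integral of
    v - v_xx is zero, so Fubini concludes ([stationary_distributional]).

    Duhamel form: since u^2 = -2u, the integrand at frequency k is the exact derivative of an
    exponential, and its end values restore what the free evolution changes ([stationary_duhamel]).
    The Riemann sums converge in H^s because the symbols k/(1+k^2) are bounded by 1, so the error in
    mode k is a k-independent multiple of the coefficient ([oscillating_Hs_RInt]).

    Sobolev bound: with L = |E|, the squared coefficients are O(L^2) ([fourier_arc_le]) and O(1/k^2)
    ([fourier_arc_decay]), uniformly over arcs; the latter uses that an arc meets a period cell in
    at most two intervals, up to finitely many points ([arc_on_cellP]). Frequencies up to 2pi/L
    contribute L^2 L^(-1-2s), higher ones the tail of the sum of k^(2s-2), which converges as s <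
    1/2; both are of order L^(1-2s) ([weighted_partial_sum_le]). A short arc then gives data of
    small norm. *)

Section Arcs.
Context {R : realType}.
Notation mu := (@lebesgue_measure R).
Notation twopi := (@twopi R).
Implicit Types E : set R.

(** * Arcs of the torus and their two-valued profile *)

Lemma twopi_gt0 : 0 < twopi.
Proof. by rewrite /Defs.twopi pmulrn_lgt0// pi_gt0. Qed.

Lemma arc_shift E (k : int) x : is_arc E -> E (x + k%:~R * twopi) <-> E x.
Proof.
move=> [I ->]; split=> -[j /= jI].
  by exists (k + j); rewrite intrD mulrDl addrA.
exists (j - k) => /=.
by rewrite (_ : _ + _ = x + j%:~R * twopi)// intrB; ring.
Qed.

Lemma arc_periodic E : is_arc E -> periodic_set E.
Proof.
by move=> aE x; have := arc_shift 1 x aE; rewrite mul1r.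
Qed.

Lemma measurable_arc E : is_arc E -> measurable E.
Proof.
move=> [I ->].
rewrite (_ : [set _ | _] =
  \bigcup_(k in [set: int]) ((fun x : R => x + k%:~R * twopi) @^-1` [set` I])).
  apply: countable_bigcupT_measurable => // k.
  rewrite -[X in measurable X]setTI.
  have : measurable_fun setT (fun x : R => x + k%:~R * twopi).
    apply: continuous_measurable_fun => y.
    by apply: cvgD; [exact: cvg_id | exact: cvg_cst].
  by apply => //; exact: measurable_itv.
by apply/seteqP; split=> x /= [k]; [exists k | move=> _; exists k].
Qed.

Lemma periodic_arc_profile E : is_arc E -> periodic (arc_profile E) twopi.
Proof.
move=> aE x; congr (_ * _); rewrite !indicE; congr (nat_of_bool _)%:R.
by apply/idP/idP; rewrite !inE => h; apply/(arc_periodic aE).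
Qed.

Lemma measurable_arc_profile E : is_arc E ->
  measurable_fun setT (arc_profile E).
Proof.
move=> aE; apply: measurable_funM; first exact: measurable_cst.
exact: measurable_indic (measurable_arc aE).
Qed.

Lemma arc_profile_norm_le E x : `|arc_profile E x| <= 2.
Proof.
rewrite /arc_profile indicE normrM normrN normr_nat.
by case: (_ \in _); rewrite ?normr1 ?normr0 ?mulr1 ?mulr0.
Qed.

Lemma arc_profile_sqr E x : arc_profile E x ^+ 2 = - 2 * arc_profile E x.
Proof.
rewrite /arc_profile indicE; case: (_ \in _); rewrite ?mulr1 ?mulr0 ?expr0n//.
Qed.

Lemma arc_profile_root E x : arc_profile E x + arc_profile E x ^+ 2 / 2%:R = 0.
Proof. by rewrite arc_profile_sqr; field. Qed.

Lemma measurable_period_cell : measurable (@period_cell R).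
Proof. exact: measurable_itv. Qed.

Lemma period_cell_lty : (mu (@period_cell R) < +oo)%E.
Proof. by rewrite lebesgue_measure_itv/=; case: ifP => _; rewrite ?ltry// -EFinB ltry. Qed.

Lemma bounded_integrable_cell (f : R -> R) (M : R) :
  measurable_fun setT f -> (forall x, `|f x| <= M) ->
  mu.-integrable period_cell (EFin \o f).
Proof.
move=> mf fM; apply: measurable_bounded_integrable.
- exact: measurable_period_cell.
- exact: period_cell_lty.
- exact: measurable_funS mf.
- exists M; split; first exact: num_real.
  by move=> N MN x _ /=; exact: le_trans (fM x) (ltW MN).
Qed.

Lemma arc_profile_L2 E : is_arc E -> in_L2 (arc_profile E).
Proof.
move=> aE; split; first exact: periodic_arc_profile.
  exact: measurable_arc_profile.
apply: (@bounded_integrable_cell (fun x => arc_profile E x ^+ 2) 4).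
  by apply: measurable_funX; exact: measurable_arc_profile.
move=> x; rewrite normrX.
by rewrite (_ : 4 = 2 ^+ 2) ?lerXn2r// ?nnegrE ?arc_profile_norm_le// expr2 -natrM.
Qed.

Lemma periodic_interior (A : set R) : periodic_set A -> periodic_set A°.
Proof.
move=> pA.
have tr (B : set R) (y c : R) : nbhs (y + c) B -> nbhs y [set x | B (x + c)].
  have cvg : (fun x : R => x + c) x @[x --> y] --> y + c.
    by apply: cvgD; [exact: cvg_id | exact: cvg_cst].
  by move=> hB; exact: cvg hB.
move=> x; split; rewrite /interior => h.
  by apply: filterS (tr _ _ _ h) => y /pA.
rewrite -[x](addrK twopi) in h; apply: filterS (tr _ _ _ h) => y /=.
by rewrite -[X in _ -> A X](subrK twopi) => /pA.
Qed.

Lemma torus_open_arcC E : is_arc E -> torus_open (~` E)°.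
Proof.
move=> aE; split; last exact: open_interior.
by apply: periodic_interior => x; split=> h /(arc_periodic aE).
Qed.

Lemma arc_profile_vanishes E : vanishes_on (~` E)° (fun=> arc_profile E).
Proof.
move=> _ x /interior_subset Ex.
by rewrite /arc_profile indicE memNset ?mulr0.
Qed.

(** A null set containing every point where the profile is nonzero would contain [E], against its
    positive measure. *)
Lemma arc_profile_nonzero E : is_arc E -> 0 < torus_measure E ->
  nonzero (arc_profile E).
Proof.
move=> aE E0 [A [mA A0 EA]]; move: E0; rewrite /torus_measure.
suff -> : mu (E `&` [set` `[0, twopi[]) = 0%E by rewrite ltxx.
apply: (subset_measure0 _ _ _ A0) => //.
  by apply: measurableI; [exact: measurable_arc | exact: measurable_itv].
move=> x [Ex _]; apply: EA => /=; apply/eqP.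
by rewrite /arc_profile indicE mem_set// mulr1 oppr_eq0 pnatr_eq0.
Qed.

End Arcs.

(** * The trace of an arc on one period cell *)

Section ArcOnCell.
Context {R : realType}.
Notation mu := (@lebesgue_measure R).
Notation twopi := (@twopi R).
Implicit Types E : set R.

(** Two intervals, either possibly empty, because an arc passing through 0 is cut by the cell. The
    finite set [F] absorbs end points, so open and closed arcs are treated alike; integrals do not
    see it. *)
Definition arc_on_cell (E : set R) (a b c d : R) : Prop :=
  [/\ 0 <= a <= b, b <= c <= d, d <= twopi &
    exists2 F : set R, finite_set F &
      forall x, 0 < x < twopi -> ~ F x -> (E x <-> a < x < b \/ c < x < d)].

Lemma arc_on_cell_full E : (forall x, E x) -> arc_on_cell E 0 twopi twopi twopi.
Proof.
have := @twopi_gt0 R => T0 Ex; split; rewrite ?lexx ?ltW//.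
by exists set0 => // x x0 _; split=> // _; left.
Qed.

Lemma arc_on_cell_empty E (F : set R) : finite_set F ->
  (forall x, 0 < x < twopi -> E x -> F x) -> arc_on_cell E 0 0 0 0.
Proof.
have := @twopi_gt0 R => T0 fF Ex; split; rewrite ?lexx ?ltW//.
exists F => // x x0 nF; split=> [/(Ex _ x0)//|].
by case=> /andP[/lt_trans h /h]; rewrite ltxx.
Qed.

(** With [int_mulr_lt2], this confines to 0 and 1 the translates that can bring a point of the cell
    into the interval. *)
Lemma int_mulr_gtN (m : int) (T : R) : 0 < T -> - T < m%:~R * T -> 0 <= m.
Proof.
move=> T0; rewrite -mulN1r ltr_pM2r// => h.
suff : (-1 < m)%R by rewrite -lezD1 addNr.
by rewrite -(ltr_int R) intrN.
Qed.

Lemma int_mulr_lt2 (m : int) (T : R) : 0 < T -> m%:~R * T < 2 * T -> m <= 1.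
Proof.
move=> T0; rewrite ltr_pM2r// => h.
suff : (m < 2)%R by rewrite -ltzD1.
by rewrite -(ltr_int R).
Qed.

Lemma exists_shift_lt (x y T : R) : 0 < T -> exists k : int, x + k%:~R * T < y.
Proof.
move=> T0; exists (Num.floor ((y - x) / T) - 1).
have := @floor_le R ((y - x) / T).
rewrite -(ler_pM2r T0) divfK ?gt_eqF//; set f := Num.floor _ => h.
by rewrite intrB mulrBl mulr1z mul1r; lra.
Qed.

Lemma exists_shift_gt (x y T : R) : 0 < T -> exists k : int, y < x + k%:~R * T.
Proof.
move=> T0; have [k] := exists_shift_lt (- x) (- y) T0.
exists (- k); rewrite intrN mulNr; lra.
Qed.

(** The two inclusions squeeze [E] between the open and the closed interval, whatever its end
    points. The cases depend on whether the interval ends inside the cell, wraps past 2pi, or has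
    length at least 2pi. *)
Lemma arc_on_cell_bounded (E : set R) (al be : R) :
  al < be -> 0 <= al < twopi ->
  (forall x, (exists k : int, al < x + k%:~R * twopi < be) -> E x) ->
  (forall x, E x -> exists k : int, al <= x + k%:~R * twopi <= be) ->
  exists a b c d, arc_on_cell E a b c d.
Proof.
have T0 := @twopi_gt0 R; set T := twopi in T0 *.
move=> ab /andP[al0 alT] Eint Ecl.
pose F := [set al; be; be - T].
have fF : finite_set F by rewrite !finite_setU; do !split.
have nF x : ~ F x -> [/\ x != al, x != be & x != be - T].
  move=> nFx; split; apply/eqP => xe; apply: nFx; rewrite /F/= xe.
  - by left; left.
  - by left; right.
  - by right.
have inE0 x : al < x < be -> E x.
  by move=> h; apply: Eint; exists 0; rewrite mul0r addr0.
have inE1 x : al < x + T < be -> E x.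
  by move=> h; apply: Eint; exists 1; rewrite mul1r.
have [beT|Tbe] := leP be T.
  exists al, be, be, be; split; rewrite ?lexx ?(ltW ab) ?al0//.
  exists F => // x /andP[x0 xT] /nF[xa xb xbT]; split.
    move=> /Ecl[k /andP[k1 k2]]; left.
    have k_ge0 : 0 <= k by apply: (@int_mulr_gtN k T T0); lra.
    have : k <= 1 by apply: (@int_mulr_lt2 k T T0); lra.
    case: k k_ge0 k1 k2 => [[|[|//]]|//] _ k1 k2 _; last by lra.
    rewrite mul0r addr0 in k1 k2.
    by rewrite lt_neqAle eq_sym xa k1 lt_neqAle xb k2.
  by case=> [/inE0//|/andP[/lt_trans h /h]]; rewrite ltxx.
have [beT2|Tbe2] := ltP be (al + T).
  (* The part beyond 2pi reappears at the start of the cell. *)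
  exists 0, (be - T), al, T; split; rewrite ?lexx//=; try lra.
  exists F => // x /andP[x0 xT] /nF[xa xb xbT]; split.
    move=> /Ecl[k /andP[k1 k2]].
    have k_ge0 : 0 <= k by apply: (@int_mulr_gtN k T T0); lra.
    have : k <= 1 by apply: (@int_mulr_lt2 k T T0); lra.
    case: k k_ge0 k1 k2 => [[|[|//]]|//] _ k1 k2 _.
      rewrite mul0r addr0 in k1 k2; right.
      by rewrite lt_neqAle eq_sym xa k1.
    rewrite mul1r in k1 k2; left.
    by rewrite x0 lt_neqAle xbT; lra.
  by case=> /andP[h1 h2]; [apply: inE1 | apply: inE0]; lra.
(* The translates now cover everything except possibly [al], which lies in [F]. *)
exists 0, al, al, T; split; rewrite ?lexx//=; try lra.
exists F => // x /andP[x0 xT] /nF[xa xb xbT]; split.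
  move=> _; have [h|h] := ltP x al; first by left; rewrite x0.
  by right; rewrite lt_neqAle eq_sym xa h.
by case=> /andP[h1 h2]; [apply: inE1 | apply: inE0]; lra.
Qed.

(** A half-line or the whole line meets every class modulo 2pi; the other unbounded forms of
    [interval] are empty. A bounded interval is translated so that it starts in the cell. *)
Lemma arc_on_cellP E : is_arc E -> exists a b c d, arc_on_cell E a b c d.
Proof.
have T0 := @twopi_gt0 R => aE.
have full : (forall x, E x) -> exists a b c d, arc_on_cell E a b c d.
  by move=> h; exists 0, twopi, twopi, twopi; exact: arc_on_cell_full.
have empty F : finite_set F -> (forall x, 0 < x < twopi -> E x -> F x) ->
    exists a b c d, arc_on_cell E a b c d.
  by move=> fF h; exists 0, 0, 0, 0; exact: arc_on_cell_empty fF h.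
case: (aE) => -[[b1 al|[]] [b2 be|[]]] EI; last first.
- by apply: (empty set0) => // x _; rewrite EI => -[k /=]; rewrite in_itv/= ?andbF.
- by apply: (empty set0) => // x _; rewrite EI => -[k /=]; rewrite in_itv/= ?andbF.
- by apply: (empty set0) => // x _; rewrite EI => -[k /=]; rewrite in_itv/= ?andbF.
- by apply: full => x; rewrite EI; exists 0; rewrite /= in_itv.
- by apply: (empty set0) => // x _; rewrite EI => -[k /=]; rewrite in_itv/= ?andbF.
- apply: full => x; rewrite EI; have [k h] := exists_shift_lt x be T0.
  by exists k; rewrite /= in_itv/=; apply: lteifS.
- apply: full => x; rewrite EI; have [k h] := exists_shift_gt x al T0.
  by exists k; rewrite /= in_itv/= andbT; apply: lteifS.
- by apply: (empty set0) => // x _; rewrite EI => -[k /=]; rewrite in_itv/= ?andbF.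
have Ecl x : E x -> exists k : int, al <= x + k%:~R * twopi <= be.
  rewrite EI => -[k /=]; rewrite in_itv/= => /andP[h1 h2]; exists k.
  by rewrite (lteifW h1) (lteifW h2).
have Eint x : (exists k : int, al < x + k%:~R * twopi < be) -> E x.
  move=> [k /andP[h1 h2]]; rewrite EI; exists k; rewrite /= in_itv/=.
  by rewrite !lteifS.
pose n := Num.floor (al / twopi).
have n1 : n%:~R * twopi <= al by rewrite -ler_pdivlMr// floor_le.
have n2 : al < n%:~R * twopi + twopi.
  rewrite -[X in _ + X]mul1r -mulrDl -ltr_pdivrMr//.
  by have := floorD1_gt (al / twopi); rewrite intrD.
have [ba|ab] := leP be al.
  (* Such an interval has at most the point [al], whose representative in the cell is
     exceptional. *)
  apply: (empty [set al - n%:~R * twopi]) => // x /andP[x0 xT].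
  move=> /Ecl[k /andP[h1 h2]] /=.
  have xk : x + k%:~R * twopi = al by apply/eqP; rewrite eq_le h1 (le_trans h2).
  suff -> : n = k by rewrite -xk addrK.
  have e1 : (n < k + 1)%R.
    rewrite -(ltr_int R) -(ltr_pM2r T0) intrD mulrDl mul1r; lra.
  have e2 : (k < n + 1)%R.
    rewrite -(ltr_int R) -(ltr_pM2r T0) intrD mulrDl mul1r; lra.
  by apply/eqP; rewrite eq_le -!ltzD1 e1 e2.
apply: (@arc_on_cell_bounded E (al - n%:~R * twopi) (be - n%:~R * twopi)).
- by rewrite ltrD2r.
- by apply/andP; split; lra.
- move=> x [k /andP[h1 h2]]; apply: Eint; exists (k + n).
  by rewrite intrD mulrDl; apply/andP; split; lra.
- move=> x /Ecl[k /andP[h1 h2]]; exists (k - n).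
  by rewrite intrB mulrBl; apply/andP; split; lra.
Qed.

End ArcOnCell.

(** * Size and decay of the Fourier coefficients of the profile *)

Section FourierDecay.
Context {R : realType}.
Notation mu := (@lebesgue_measure R).
Notation twopi := (@twopi R).
Implicit Types E : set R.

(** The bound ignores the length of the segment: for g = cos(kx) the primitive is sin(kx)/k, and
    this is the source of the 1/|k| decay. *)
Lemma Rintegral_derive_le (g G : R -> R) (M a b : R) :
  continuous g -> (forall x : R, is_derive x (1 : R) G (g x)) ->
  (forall x, `|G x| <= M) -> a <= b ->
  `|\int[mu]_(x in [set` `[a, b]]) g x| <= 2 * M.
Proof.
move=> cg dG GM; rewrite le_eqVlt => /predU1P[<-|ab].
  rewrite set_itv1 Rintegral_set1 normr0.
  by rewrite mulr_ge0// (le_trans _ (GM 0)).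
have cG : continuous G.
  by move=> x; apply/differentiable_continuous/derivable1_diffP; case: (dG x).
rewrite /Rintegral (@continuous_FTC2 _ g G)//=.
- by rewrite mulr2n mulrDl mul1r (le_trans (ler_normB _ _))// lerD.
- exact: continuous_subspaceT.
- split.
  + by move=> x _; case: (dG x).
  + by apply: cvg_at_right_filter; exact: cG.
  + by apply: cvg_at_left_filter; exact: cG.
- by move=> x _; rewrite derive1E; case: (dG x).
Qed.

Lemma continuous_segment_integrable (g : R -> R) (a b : R) : continuous g ->
  mu.-integrable [set` `[a, b]] (EFin \o g).
Proof.
move=> cg; apply: continuous_compact_integrable; first exact: segment_compact.
exact: continuous_subspaceT.
Qed.

Lemma Rintegral_arc E (a b c d : R) (g : R -> R) :
  is_arc E -> arc_on_cell E a b c d -> continuous g ->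
  \int[mu]_(x in period_cell) (\1_E x * g x) =
  \int[mu]_(x in [set` `[a, b]]) g x + \int[mu]_(x in [set` `[c, d]]) g x.
Proof.
move=> aE [/andP[a0 ab] /andP[bc cd] dT [F fF EF]] cg.
have mg : measurable_fun setT g by exact: continuous_measurable_fun.
have mc := @measurable_period_cell R.
have sub1 : [set` `[a, b]] `<=` @period_cell R.
  by move=> x; rewrite /period_cell /= !in_itv/= => /andP[? ?]; apply/andP; split; lra.
have sub2 : [set` `[c, d]] `<=` @period_cell R.
  by move=> x; rewrite /period_cell /= !in_itv/= => /andP[? ?]; apply/andP; split; lra.
have restr (u v : R) : [set` `[u, v]] `<=` @period_cell R ->
  \int[mu]_(x in [set` `[u, v]]) g x =
  \int[mu]_(x in period_cell) (\1_[set` `[u, v]] x * g x).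
  move=> uvT; rewrite -[in LHS](setIidr uvT) Rintegral_mkcondr.
  apply: eq_Rintegral => x _; rewrite patchE indicE.
  by case: ifP => _; rewrite ?mul1r ?mul0r.
have mh (D : set R) : measurable D -> measurable_fun setT (fun x => \1_D x * g x).
  by move=> mD; apply: measurable_funM => //; exact: measurable_indic.
have ih (u v : R) : mu.-integrable period_cell
    (EFin \o (fun x => \1_[set` `[u, v]] x * g x)).
  have ig := @continuous_segment_integrable g 0 twopi cg.
  apply: le_integrable ig => //.
    apply/measurable_EFinP; apply: (measurable_funS measurableT) => //.
    by apply: mh; exact: measurable_itv.
  move=> x _ /=; rewrite lee_fin indicE normrM.
  by case: (_ \in _); rewrite ?normr1 ?mul1r// normr0 mul0r.
rewrite !restr// -RintegralD//.
rewrite /Rintegral; congr fine; apply: ae_eq_integral => //.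
- apply/measurable_EFinP; apply: (measurable_funS measurableT) => //.
  by apply: mh; exact: measurable_arc.
- apply/measurable_EFinP; apply: (measurable_funS measurableT) => //.
  by apply: measurable_funD; apply: mh; exact: measurable_itv.
(* The cell boundary is added because [arc_on_cell] describes only its interior, and the end points
   because the integrals on the right run over closed segments. *)
pose N := F `|` [set 0; twopi; a; b; c; d].
have fN : finite_set N by rewrite /N !finite_setU; do !split.
exists N; split.
- by apply: countable_measurable => //; exact: finite_set_countable.
- by apply: countable_lebesgue_measure0; exact: finite_set_countable.
move=> x /= h; apply: contrapT => nN; apply: h => xc; congr EFin.
have nF : ~ F x by move=> Fx; apply: nN; left.
have ne y : [set 0; twopi; a; b; c; d] y -> x != y.
  by move=> Sy; apply/eqP => xy; apply: nN; right; rewrite xy.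
have [x0 xT xa xb [xc' xd]] :
    [/\ x != 0, x != twopi, x != a, x != b & x != c /\ x != d].
  by do !split; apply: ne; rewrite /=; intuition.
move: xc; rewrite /period_cell/= in_itv/= => /andP[h0 hT].
have xin : 0 < x < twopi by rewrite !lt_neqAle eq_sym x0 h0 xT hT.
have {EF} := EF x xin nF.
rewrite !indicE -mulrDl => EF; congr (_ * _).
rewrite (_ : (x \in [set` `[a, b]]) = (a < x < b)); last first.
  apply/idP/idP; rewrite inE/= in_itv/= => /andP[h1 h2]; last by rewrite !ltW.
  by rewrite !lt_neqAle h1 h2 (eq_sym a) xa xb.
rewrite (_ : (x \in [set` `[c, d]]) = (c < x < d)); last first.
  apply/idP/idP; rewrite inE/= in_itv/= => /andP[h1 h2]; last by rewrite !ltW.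
  by rewrite !lt_neqAle h1 h2 (eq_sym c) xc' xd.
case: (boolP (x \in E)) => [/set_mem/EF[] h|/negP Ex].
- rewrite h (_ : (c < x < d) = false) ?addr0//; lra.
- rewrite h (_ : (a < x < b) = false) ?add0r//; lra.
- have [h1 h2] : ~ (a < x < b) /\ ~ (c < x < d).
    by split=> h; apply: Ex; rewrite inE; apply/EF; tauto.
  by rewrite (negbTE (introN idP h1)) (negbTE (introN idP h2)) addr0.
Qed.

(** The constant 8 is the height 2 of the profile times 2M for each of the two intervals. *)
Lemma arc_profile_integral_decay E (g G : R -> R) (M : R) : is_arc E ->
  continuous g -> (forall x : R, is_derive x (1 : R) G (g x)) ->
  (forall x, `|G x| <= M) ->
  `|\int[mu]_(x in period_cell) (arc_profile E x * g x)| <= 8 * M.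
Proof.
move=> aE cg dG GM; have [a [b [c [d abcd]]]] := arc_on_cellP aE.
under eq_Rintegral do rewrite /arc_profile -mulrA.
have mc := @measurable_period_cell R.
rewrite RintegralZl//; last first.
  apply: le_integrable (@continuous_segment_integrable g 0 twopi cg) => //.
    apply/measurable_EFinP; apply: (measurable_funS measurableT) => //.
    apply: measurable_funM; first exact: measurable_indic (measurable_arc aE).
    exact: continuous_measurable_fun.
  move=> x _ /=; rewrite lee_fin indicE normrM.
  by case: (_ \in _); rewrite ?normr1 ?mul1r// normr0 mul0r.
rewrite (Rintegral_arc aE abcd cg) normrM normrN normr_nat.
case: abcd => /andP[_ ab] /andP[_ cd] _ _.
rewrite (_ : 8 * M = 2 * (2 * M + 2 * M)); last by ring.
by rewrite ler_pM2l// (le_trans (ler_normD _ _))// lerD// (Rintegral_derive_le cg dG).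
Qed.

Lemma torus_measureE E : is_arc E ->
  torus_measure E = \int[mu]_(x in period_cell) \1_E x.
Proof.
move=> aE; have mE := measurable_arc aE.
rewrite /period_cell -Rintegral_itv_bndo_bndc.
  by rewrite /Rintegral integral_indic//; exact: measurable_itv.
apply: integrableS (@bounded_integrable_cell R \1_E 1 _ _).
- exact: measurable_period_cell.
- exact: measurable_itv.
- by move=> x; rewrite /period_cell /= !in_itv/= => /andP[-> /ltW].
- exact: measurable_indic.
- by move=> x; rewrite indicE normr_nat lern1; case: (_ \in _).
Qed.

Lemma arc_profile_integral_le E (g : R -> R) : is_arc E ->
  continuous g -> (forall x, `|g x| <= 1) ->
  `|\int[mu]_(x in period_cell) (arc_profile E x * g x)| <= 2 * torus_measure E.
Proof.
move=> aE cg g1; have mE := measurable_arc aE.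
have mc := @measurable_period_cell R.
have i1 : mu.-integrable period_cell (EFin \o (\1_E : R -> R)).
  apply: (@bounded_integrable_cell R \1_E 1); first exact: measurable_indic.
  by move=> x; rewrite indicE normr_nat lern1; case: (_ \in _).
have h x : `|arc_profile E x * g x| <= 2 * \1_E x.
  rewrite normrM /arc_profile normrM normrN !normr_nat indicE.
  by rewrite -[leRHS]mulr1 ler_wpM2l.
have ig : mu.-integrable period_cell (EFin \o (fun x => arc_profile E x * g x)).
  apply: (@bounded_integrable_cell R _ 2).
    apply: measurable_funM; first exact: measurable_arc_profile.
    exact: continuous_measurable_fun.
  move=> x; rewrite (le_trans (h x))// indicE.
  by case: (_ \in _); rewrite ?mulr1 ?mulr0.
rewrite (le_trans (le_normr_Rintegral _ _))// torus_measureE// -RintegralZl//.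
apply: le_Rintegral => //.
- exact: integrable_norm ig.
- by apply: integrableZl i1.
Qed.

Lemma cosM_continuous (k : R) : continuous (fun x : R => cos (k * x)).
Proof.
move=> x; apply: continuous_comp; last exact: continuous_cos.
exact: mulrl_continuous.
Qed.

Lemma sinM_continuous (k : R) : continuous (fun x : R => sin (k * x)).
Proof.
move=> x; apply: continuous_comp; last exact: continuous_sin.
exact: mulrl_continuous.
Qed.

Lemma normc_sqr (a b : R) :
  ComplexField.Normc.normc (a +i* b)%C ^+ 2 = a ^+ 2 + b ^+ 2.
Proof. by rewrite /= sqr_sqrtr// addr_ge0// sqr_ge0. Qed.

Lemma twopi_ge1 : 1 <= twopi.
Proof. by rewrite /Defs.twopi; have := @pi_ge2 R; lra. Qed.

(** Each of the real and imaginary parts costs M^2, the normalization 1/(2pi) being at most 1. *)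
Lemma normc_sqr_le (a b M : R) : `|a| <= M -> `|b| <= M ->
  ComplexField.Normc.normc ((twopi^-1 * a) -i* (twopi^-1 * b))%C ^+ 2
  <= 2 * M ^+ 2.
Proof.
have T1 := twopi_ge1 => aM bM.
have h c : `|c| <= M -> (twopi^-1 * c) ^+ 2 <= M ^+ 2.
  move=> cM; rewrite -[X in X <= _]real_normK ?num_real// lerXn2r ?nnegrE//.
    by rewrite (le_trans _ cM).
  rewrite normrM (le_trans _ cM)// -[leRHS]mul1r ler_wpM2r// normfV.
  by rewrite invf_le1 gtr0_norm// (lt_le_trans ltr01).
by rewrite normc_sqr sqrrN mulr2n mulrDl mul1r lerD// h.
Qed.

Lemma fourier_arc_le E k : is_arc E ->
  ComplexField.Normc.normc (fourier (arc_profile E) k) ^+ 2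
  <= 8 * torus_measure E ^+ 2.
Proof.
move=> aE; rewrite (_ : 8 * _ = 2 * (2 * torus_measure E) ^+ 2); last by ring.
apply: normc_sqr_le; apply: arc_profile_integral_le => //.
- exact: cosM_continuous.
- by move=> x; exact: cos_max.
- exact: sinM_continuous.
- by move=> x; exact: sin_max.
Qed.

Lemma fourier_arc_decay E k : is_arc E -> k != 0 ->
  ComplexField.Normc.normc (fourier (arc_profile E) k) ^+ 2
  <= 128 / k%:~R ^+ 2.
Proof.
move=> aE k0; have k0R : k%:~R != 0 :> R by rewrite intr_eq0.
rewrite (_ : 128 / _ = 2 * (8 * `|(k%:~R : R)^-1|) ^+ 2); last first.
  by rewrite exprMn real_normK ?num_real//; field.
apply: normc_sqr_le.
- apply: (@arc_profile_integral_decay E _ (fun x => sin (k%:~R * x) / k%:~R)) => //.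
  + exact: cosM_continuous.
  + move=> x; apply: is_derive_eq.
    by rewrite ?scaler0 ?add0r /GRing.scale/= mulr1; field.
  + by move=> x; rewrite normrM -[leRHS]mul1r ler_wpM2r// sin_max.
- apply: (@arc_profile_integral_decay E _ (fun x => - (cos (k%:~R * x) / k%:~R))) => //.
  + exact: sinM_continuous.
  + move=> x; apply: is_derive_eq.
    by rewrite ?scaler0 ?add0r /GRing.scale/= mulr1; field.
  + by move=> x; rewrite normrN normrM -[leRHS]mul1r ler_wpM2r// cos_max.
Qed.

End FourierDecay.

(** * Weighted sums and the bound by |E|^(1-2s) *)

Section SobolevSum.
Context {R : realType}.
Notation twopi := (@twopi R).
Notation mu := (@lebesgue_measure R).

(** Discrete form of integrating x^(-sg-1). With m = n+1 and n = m(1 - 1/m), it reduces to 1 + sg/m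
    <= (1 - 1/m)^(-sg), which follows from 1 + x <= exp x and ln(1 - 1/m) <= -1/m. *)
Lemma powR_telescope (sg : R) (n : nat) : 0 <= sg -> (0 < n)%N ->
  sg * n.+1%:R `^ (- sg - 1) <= n%:R `^ (- sg) - n.+1%:R `^ (- sg).
Proof.
move=> sg0 n0; set m : R := n.+1%:R.
have m0 : 0 < m by rewrite ltr0n.
have mN : m != 0 by rewrite gt_eqF.
have nE : n%:R = m * (1 - m^-1) by rewrite mulrBr mulr1 divff ?gt_eqF// /m -natr1 addrK.
have m1 : 0 < 1 - m^-1 by rewrite subr_gt0 invf_lt1// ltr1n.
rewrite nE powRM ?(ltW m0) ?(ltW m1)// powRB ?mN ?implybT// powRr1 ?(ltW m0) ?(ltW m1)//.
rewrite -[X in _ - X]mulr1 -mulrBr mulrCA ler_wpM2l ?powR_ge0//.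
rewrite lerBrDl /powR gt_eqF// (le_trans (expR_ge1Dx (sg / m)))//.
rewrite ler_expR mulNr -mulrN ler_wpM2l// lerNr.
by apply: le_ln1Dx; rewrite ltrN2 invf_lt1// ltr1n.
Qed.

Lemma sobolev_weight_le (s : R) (n : nat) : 0 <= s <= 1 -> (0 < n)%N ->
  (1 + n%:R ^+ 2) `^ s <= 2 * n%:R `^ (2 * s).
Proof.
move=> /andP[s0 s1] n0; have n1 : 1 <= n%:R :> R by rewrite ler1n.
have n2 : 1 <= n%:R ^+ 2 :> R by rewrite exprn_ege1.
have h : (2 * n%:R ^+ 2) `^ s <= 2 * n%:R `^ (2 * s) :> R.
  rewrite powRM ?sqr_ge0// powRrM powR_mulrn// ler_wpM2r ?powR_ge0//.
  by apply: ler1_powR => //; rewrite ler1n.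
apply: le_trans h; apply: ge0_ler_powR => //; rewrite ?nnegrE; lra.
Qed.

(** The sum is cut at N, the integer part of P = 2pi/L, where the bounds L^2 and 1/n^2 are
    comparable. The two summands of the constant come from the head and the tail. *)
Lemma weighted_partial_sum_le (s L : R) (g : nat -> R) (M : nat) :
  0 <= s < 2^-1 -> 0 < L <= twopi ->
  (forall n, 0 <= g n) -> (forall n, g n <= L ^+ 2) ->
  (forall n, (0 < n)%N -> g n <= (n%:R ^+ 2)^-1) ->
  \sum_(n < M) (1 + n%:R ^+ 2) `^ s * g n <=
  (4 * twopi `^ (1 + 2 * s) + 2 / (1 - 2 * s) * (twopi / 2) `^ (- (1 - 2 * s)))
  * L `^ (1 - 2 * s).
Proof.
move=> /andP[s0 s12] /andP[L0 LT] g0 gL gn.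
have T0 := @twopi_gt0 R; set sg := 1 - 2 * s; have sg0 : 0 < sg by rewrite /sg; lra.
pose P := twopi / L; have P1 : 1 <= P by rewrite ler_pdivlMr// mul1r.
have P0 : 0 < P by rewrite (lt_le_trans ltr01).
pose N := Num.truncn P; have /andP[NP PN] : N%:R <= P < N.+1%:R.
  by apply: truncn_itv; exact: ltW.
have N0 : (0 < N)%N by rewrite lt0n; apply/eqP => N0; move: PN; rewrite N0; lra.
have N1 : 1 <= N%:R :> R by rewrite ler1n.
pose w n := (1 + n%:R ^+ 2) `^ s * g n.
have w0 n : 0 <= w n by rewrite mulr_ge0// powR_ge0.
(* Padding with nonnegative terms lets the cut at N be made even when M is smaller. *)
have mono : \sum_(n < M) w n <= \sum_(n < N.+1 + M) w n.
  rewrite -!(big_mkord xpredT) (big_cat_nat (n := M) _ (leq_addl _ _))//=.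
  by rewrite lerDl sumr_ge0.
apply: (le_trans mono); rewrite big_split_ord/= mulrDl lerD//.
  have head n : (n <= N)%N -> w n <= 2 * P `^ (2 * s) * L ^+ 2.
    move=> nN; rewrite ler_pM ?powR_ge0//.
    have h1 : (1 + n%:R ^+ 2) `^ s <= (1 + N%:R ^+ 2) `^ s :> R.
      apply: ge0_ler_powR; rewrite ?nnegrE ?addr_ge0 ?sqr_ge0// lerD2l.
      by rewrite lerXn2r ?nnegrE// ler_nat.
    rewrite (le_trans h1)// (le_trans (@sobolev_weight_le s N _ N0))//; first lra.
    rewrite ler_wpM2l//; by apply: ge0_ler_powR; rewrite ?nnegrE ?(ltW P0) ?mulr_ge0.
  apply: (@le_trans _ _ (\sum_(i < N.+1) 2 * P `^ (2 * s) * L ^+ 2)).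
    by apply: ler_sum => i _; apply: head; rewrite -ltnS.
  rewrite sumr_const card_ord -[_ *+ _]mulr_natr.
  (* The head has N+1 terms, at most 2P of them since N <= P and 1 <= P. *)
  have NP2 : N.+1%:R <= 2 * P by rewrite -natr1; lra.
  apply: (@le_trans _ _ (2 * P `^ (2 * s) * L ^+ 2 * (2 * P))).
    apply: ler_wpM2l NP2; rewrite mulr_ge0 ?sqr_ge0//.
    by rewrite mulr_ge0 ?powR_ge0.
  have -> : 2 * P `^ (2 * s) * L ^+ 2 * (2 * P) = 4 * (P `^ (1 + 2 * s) * L ^+ 2).
    by rewrite powRD ?(gt_eqF P0) ?implybT// powRr1 ?(ltW P0)//; ring.
  rewrite -mulrA ler_wpM2l// /P powRM ?invr_ge0 ?(ltW T0) ?(ltW L0)// -mulrA ler_wpM2l ?powR_ge0//.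
  rewrite -powR_inv1 ?(ltW L0)// -powRrM -powR_mulrn ?(ltW L0)// -powRD ?(gt_eqF L0) ?implybT//.
  by rewrite (_ : -1 * _ + _ = sg)// /sg; lra.
(* Here the summand is at most 2 m^(2s-2) = 2 m^(-sg-1), which telescopes. *)
have tail n : w (N.+1 + n)%N <= 2 / sg *
    ((N + n)%:R `^ (- sg) - (N + n).+1%:R `^ (- sg)).
  have n0 : (0 < N + n)%N by rewrite addn_gt0 N0.
  rewrite -mulrA (le_trans _ (_ : 2 * (N + n).+1%:R `^ (- sg - 1) <= _))//; last first.
    rewrite ler_wpM2l// mulrC ler_pdivlMr// mulrC.
    by apply: powR_telescope => //; exact: ltW.
  rewrite addSn; set m := (N + n).+1; have m0 : (0 : R) < m%:R by rewrite ltr0n.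
  have -> : 2 * m%:R `^ (- sg - 1) = 2 * m%:R `^ (2 * s) * (m%:R ^+ 2)^-1 :> R.
    rewrite -mulrA -powR_mulrn ?(ltW m0)// -powRN -powRD ?(gt_eqF m0) ?implybT//.
    by congr (_ * _ `^ _); rewrite /sg; lra.
  rewrite ler_pM ?powR_ge0//; last exact: gn.
  by apply: sobolev_weight_le => //; lra.
apply: (@le_trans _ _ (\sum_(i < M) 2 / sg *
    ((N + i)%:R `^ (- sg) - (N + i).+1%:R `^ (- sg)))).
  by apply: ler_sum => i _; exact: tail.
rewrite -mulr_sumr -!mulrA ler_wpM2l// ler_wpM2l ?invr_ge0 ?(ltW sg0)//.
have -> : \sum_(i < M) ((N + i)%:R `^ (- sg) - (N + i).+1%:R `^ (- sg)) =
    N%:R `^ (- sg) - (N + M)%:R `^ (- sg) :> R.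
  elim: M {mono} => [|m IH]; first by rewrite big_ord0 addn0 subrr.
  by rewrite big_ord_recr/= IH addnS; ring.
apply: (@le_trans _ _ (N%:R `^ (- sg))); first by rewrite gerBl powR_ge0.
(* P < N+1 <= 2N, so N is at least P/2. *)
have PN2 : twopi / 2 / L <= N%:R.
  have -> : twopi / 2 / L = P / 2 by rewrite /P mulrAC.
  move: PN; rewrite -natr1; lra.
have T20 : 0 < twopi / 2 by rewrite divr_gt0.
have Q0 : 0 < twopi / 2 / L by rewrite divr_gt0.
have h : (twopi / 2 / L) `^ sg <= N%:R `^ sg.
  by apply: ge0_ler_powR; rewrite ?nnegrE ?(ltW sg0) ?(ltW Q0).
apply: (@le_trans _ _ ((twopi / 2 / L) `^ (- sg))).
  by rewrite !powRN lef_pV2 ?posrE ?powR_gt0 ?divr_gt0// ltr0n.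
rewrite powRM ?invr_ge0 ?(ltW T20) ?(ltW L0)// -(powR_inv1 (ltW L0)) -powRrM.
by rewrite mulrNN mul1r.
Qed.

(** The nonnegative and the negative integers each contribute at most B; the latter miss the term at
    0. *)
Lemma esum_int_le (f : int -> R) (g : nat -> R) (B : R) :
  (forall n, 0 <= g n) -> (forall k, f k <= g `|k|%N) ->
  (forall M, \sum_(n < M) g n <= B) ->
  (\esum_(k in [set: int]) (f k)%:E <= (B + B)%:E)%E.
Proof.
move=> g0 fg gB.
have gBe : (\esum_(n in [set: nat]) (g n)%:E <= B%:E)%E.
  rewrite -nneseries_esumT//.
  apply: lime_le; first by apply: is_cvg_nneseries => n _ _; rewrite lee_fin.
  by apply: nearW => M; rewrite sumEFin lee_fin big_mkord.
have fge : (\esum_(k in [set: int]) (f k)%:E <=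
    \esum_(k in [set: int]) (g `|k|%N)%:E)%E.
  by apply: le_esum => k _; rewrite lee_fin.
apply: (le_trans fge); rewrite (esumID (range Posz))//; last first.
  by move=> k _; rewrite lee_fin.
rewrite !setTI EFinD leeD//.
  rewrite (@reindex_esum _ _ _ [set: nat] _ Posz)//.
  split; [by move=> n _; exists n|by move=> m n _ _ []|].
  by move=> k [n _ <-]; exists n.
rewrite (@reindex_esum _ _ _ [set: nat] _ Negz)//; last first.
  split; [by move=> n _ []|by move=> m n _ _ []|].
  by move=> [n|n] /= h; [case: h; exists n | exists n].
apply: le_trans gBe.
rewrite -(@reindex_esum _ _ _ [set: nat] [set n | (0 < n)%N] S (fun n => (g n)%:E)).
  rewrite [leRHS](esumID [set n | (0 < n)%N]) ?setTI; last first.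
    by move=> n _; rewrite lee_fin.
  by rewrite leeDl// esum_ge0// => n _; rewrite lee_fin.
split=> //; first by move=> m n _ _ [].
by move=> [|n]//= _; exists n.
Qed.

Lemma Hs_norm2_arc_profile_le (s : R) : 0 <= s < 2^-1 ->
  exists2 C : R, 0 <= C & forall E : set R, is_arc E -> 0 < torus_measure E ->
  (Hs_norm2 s (fourier (arc_profile E))
     <= (C * torus_measure E `^ (1 - 2 * s))%:E)%E.
Proof.
move=> s01; have /andP[s0 s12] := s01.
set K := (4 * twopi `^ (1 + 2 * s) + 2 / (1 - 2 * s) * (twopi / 2) `^ (- (1 - 2 * s))).
have K0 : 0 <= K.
  rewrite addr_ge0// mulr_ge0 ?powR_ge0// divr_ge0//; lra.
(* 128 bounds both coefficient constants, and 2 counts the two halves of the integers. *)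
exists (256 * K); first by rewrite mulr_ge0.
move=> E aE L0; set L := torus_measure E in L0 *.
have LT : L <= twopi.
  have Tf : mu [set` `[0, twopi[] = twopi%:E.
    by rewrite lebesgue_measure_itv/= lte_fin twopi_gt0 oppr0 adde0.
  rewrite -[leRHS]/(fine twopi%:E) -Tf fine_le//.
  - rewrite ge0_fin_numE// (le_lt_trans _ (ltry twopi))// -Tf.
    by apply: le_measure; rewrite ?inE//; apply: measurableI => //; exact: measurable_arc.
  - by rewrite Tf.
  - by apply: le_measure; rewrite ?inE//; apply: measurableI => //; exact: measurable_arc.
(* At n = 0 the inverse is 0 by convention and would make the majorant vanish, hence the separate
   branch. *)
pose g n := 128 * Num.min (L ^+ 2) (if (0 < n)%N then (n%:R ^+ 2)^-1 else L ^+ 2) : R.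
pose f n := ((1 + n%:R ^+ 2) `^ s * g n).
have g0 n : 0 <= g n.
  by rewrite mulr_ge0// le_min sqr_ge0; case: ifP => _; rewrite ?sqr_ge0// invr_ge0 sqr_ge0.
have -> : 256 * K * L `^ (1 - 2 * s) =
   128 * (K * L `^ (1 - 2 * s)) + 128 * (K * L `^ (1 - 2 * s)) by ring.
apply: (@esum_int_le _ f).
- by move=> n; rewrite mulr_ge0 ?powR_ge0.
- move=> k; rewrite /f natr_absz intr_norm real_normK ?num_real//.
  rewrite ler_wpM2l ?powR_ge0// /g minr_pMr// le_min.
  have h1 : ComplexField.Normc.normc (fourier (arc_profile E) k) ^+ 2 <= 128 * L ^+ 2.
    by rewrite (le_trans (fourier_arc_le k aE))// ler_wpM2r ?sqr_ge0// ler_nat.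
  rewrite h1/= absz_gt0; case: ifPn => k0//.
  by rewrite natr_absz intr_norm real_normK ?num_real// fourier_arc_decay.
- move=> M; rewrite [leLHS](_ : _ = 128 * \sum_(n < M) (1 + n%:R ^+ 2) `^ s * (g n / 128)).
    rewrite ler_wpM2l//.
    apply: (@weighted_partial_sum_le s L (fun n => g n / 128) M) => //.
    + by rewrite L0.
    + by move=> n; rewrite divr_ge0.
    + by move=> n; rewrite /g mulrAC divff// mul1r ge_min lexx.
    + by move=> n n0; rewrite /g n0 mulrAC divff// mul1r ge_min lexx orbT.
  by rewrite mulr_sumr; apply: eq_bigr => i _; rewrite /f; field.
Qed.

End SobolevSum.

(** * Riemann sums in H^s and the Duhamel formula *)

Section Duhamel.
Context {R : realType}.
Notation normc := (@ComplexField.Normc.normc R).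
Implicit Types (c e : @coeffs R) (s : R).

Lemma Hs_norm2_ge0 s c : (0 <= Hs_norm2 s c)%E.
Proof. by apply: esum_ge0 => k _; rewrite lee_fin mulr_ge0 ?powR_ge0 ?sqr_ge0. Qed.

Lemma Hs_norm_lty s c : (Hs_norm s c < +oo)%E = (Hs_norm2 s c < +oo)%E.
Proof.
have h := Hs_norm2_ge0 s c.
by rewrite -!ge0_fin_numE ?sqrte_ge0// /Hs_norm sqrte_fin_num.
Qed.

Lemma Hs_norm_dominated s (M : R) c e : 0 <= M ->
  (forall k, normc (e k) <= M * normc (c k)) ->
  (Hs_norm s e <= M%:E * Hs_norm s c)%E.
Proof.
move=> M0 h; have nc (z : R[i]) : 0 <= normc z by case: z => a b; exact: sqrtr_ge0.
suff h2 : (Hs_norm2 s e <= (M ^+ 2)%:E * Hs_norm2 s c)%E.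
  rewrite /Hs_norm (_ : M%:E = sqrte (M ^+ 2)%:E); last first.
    by rewrite /= sqrtr_sqr ger0_norm.
  rewrite -sqrteM ?lee_fin ?sqr_ge0// lee_sqrt//.
  by rewrite mule_ge0 ?lee_fin ?sqr_ge0 ?Hs_norm2_ge0.
apply: ge_ereal_sup => _ /= [X [fX _] <-].
apply: (@le_trans _ _ (\sum_(k \in X) ((M ^+ 2)%:E *
    ((1 + k%:~R ^+ 2) `^ s * normc (c k) ^+ 2)%:E)%E)%R).
  apply: lee_fsum => // k _; rewrite -EFinM lee_fin [leRHS]mulrCA.
  by rewrite ler_wpM2l ?powR_ge0// -exprMn lerXn2r ?nnegrE ?mulr_ge0.
rewrite -ge0_mule_fsumr; last first.
  by move=> k; rewrite lee_fin mulr_ge0 ?powR_ge0 ?sqr_ge0.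
rewrite lee_wpmul2l ?lee_fin ?sqr_ge0// /Hs_norm2.
by apply: esum_ge; exists X => //; split.
Qed.

(** Mean value theorem twice: f q - f p = (q - p) f'(xi), and f' tau - f' xi is at most K times
    their distance. *)
Lemma riemann_rectangle_error (f f' f'' : R -> R) (K p tau q : R) :
  (forall x : R, is_derive x (1 : R) f (f' x)) ->
  (forall x : R, is_derive x (1 : R) f' (f'' x)) ->
  (forall x, `|f'' x| <= K) -> p <= tau <= q ->
  `|(q - p) * f' tau - (f q - f p)| <= K * (q - p) ^+ 2.
Proof.
move=> df df' f''K /andP[ptau tauq]; have pq := le_trans ptau tauq.
have cont (g g' : R -> R) : (forall x : R, is_derive x (1 : R) g (g' x)) -> continuous g.
  move=> dg x; apply/differentiable_continuous/derivable1_diffP.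
  by case: (dg x).
have K0 : 0 <= K by rewrite (le_trans _ (f''K 0)).
have [xi] := @MVT_segment R f f' p q pq (fun x _ => df x)
  (continuous_subspaceT (cont _ _ df)).
rewrite in_itv/= => /andP[pxi xiq] ->.
rewrite mulrC -mulrBl normrM (ger0_norm (_ : 0 <= q - p)) ?subr_ge0//.
rewrite expr2 mulrA ler_wpM2r ?subr_ge0//.
wlog xt : xi tau ptau tauq pxi xiq / xi <= tau.
  move=> h; have [xt|/ltW tx] := leP xi tau; first exact: h.
  by rewrite distrC; exact: h.
have [eta _ ->] := @MVT_segment R f' f'' xi tau xt (fun x _ => df' x)
  (continuous_subspaceT (cont _ _ df')).
rewrite normrM ler_pM// ger0_norm ?subr_ge0//; lra.
Qed.

Lemma normc_le_add (a b : R) : normc (a +i* b)%C <= `|a| + `|b|.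
Proof.
rewrite -[leRHS]ger0_norm ?addr_ge0// -sqrtr_sqr /= ler_sqrt ?sqr_ge0//.
rewrite sqrrD !real_normK ?num_real// -addrA [leRHS]addrCA addrC -!addrA.
by rewrite addrC -subr_ge0 (_ : _ - _ = `|a| * `|b| *+ 2) ?mulrn_wge0 ?mulr_ge0//; ring.
Qed.

Lemma normc_cis (x : R) : normc (cis x) = 1.
Proof. by rewrite /= cos2Dsin2 sqrtr1. Qed.

(** The sampled function is the derivative of cis(lam (x - t)); the real and imaginary parts each
    have second derivative at most lam^2 <= 1. *)
Lemma cis_rectangle_error (lam t p tau q : R) : `|lam| <= 1 -> p <= tau <= q ->
  normc ((real_complex R) (q - p) * ((0 +i* lam)%C * cis (lam * (tau - t)))
         - (cis (lam * (q - t)) - cis (lam * (p - t))))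
  <= 2 * (q - p) ^+ 2.
Proof.
move=> lam1 ptq.
have lam2 x : `|x| <= 1 -> `|lam ^+ 2 * x| <= 1.
  by move=> x1; rewrite normrM normrX mulr_ile1// exprn_ile1.
have e1 := @riemann_rectangle_error (fun x => cos (lam * (x - t)))
  (fun x => - lam * sin (lam * (x - t))) (fun x => - (lam ^+ 2 * cos (lam * (x - t))))
  1 p tau q.
have e2 := @riemann_rectangle_error (fun x => sin (lam * (x - t)))
  (fun x => lam * cos (lam * (x - t))) (fun x => - (lam ^+ 2 * sin (lam * (x - t))))
  1 p tau q.
rewrite (_ : _ - _ =
  ((q - p) * (- lam * sin (lam * (tau - t)))
   - (cos (lam * (q - t)) - cos (lam * (p - t))))
  +i* ((q - p) * (lam * cos (lam * (tau - t)))
       - (sin (lam * (q - t)) - sin (lam * (p - t)))))%C; last first.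
  by apply/eqP; rewrite eq_complex /=; apply/andP; split; apply/eqP; ring.
rewrite (le_trans (normc_le_add _ _))// -[2]/(1 + 1 : R) [leRHS]mulrDl lerD//.
  apply: e1 => //.
  - move=> x; apply: is_derive_eq; rewrite /GRing.scale/=; ring.
  - move=> x; apply: is_derive_eq; rewrite /GRing.scale/=; ring.
  - by move=> x; rewrite normrN; apply: lam2; exact: cos_max.
apply: e2 => //.
- move=> x; apply: is_derive_eq; rewrite /GRing.scale/=; ring.
- move=> x; apply: is_derive_eq; rewrite /GRing.scale/=; ring.
- by move=> x; rewrite normrN; apply: lam2; exact: sin_max.
Qed.

Lemma le_normc_sum (n : nat) (z : nat -> R[i]) :
  normc (\sum_(j < n) z j) <= \sum_(j < n) normc (z j).
Proof.
elim: n => [|n IH]; first by rewrite !big_ord0 ComplexField.Normc.normc0.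
by rewrite !big_ord_recr/= (le_trans (le_normcD _ _))// lerD2r.
Qed.

(** The integral is the increment of z_k cis(lam_k (r - t)). Telescoping that increment along the
    partition leaves rectangle errors of at most 2 d (b - a) |z_k| in total, with a factor free of
    k, so [Hs_norm_dominated] applies. *)
Lemma oscillating_Hs_RInt s (z : @coeffs R) (lam : int -> R) (t a b : R) :
  (Hs_norm s z < +oo)%E -> (forall k, `|lam k| <= 1) -> a <= b ->
  is_Hs_RInt s (fun r k => z k * ((0 +i* lam k)%C * cis (lam k * (r - t)))) a b
    (fun k => z k * (cis (lam k * (b - t)) - cis (lam k * (a - t)))).
Proof.
move=> zoo lam1 ab; have nc (w : R[i]) : 0 <= normc w by case: w => ? ?; exact: sqrtr_ge0.
have zf : Hs_norm s z = (fine (Hs_norm s z))%:E.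
  by rewrite fineK// ge0_fin_numE// sqrte_ge0.
set N := fine (Hs_norm s z) in zf.
have N0 : 0 <= N by rewrite -lee_fin -zf sqrte_ge0.
split=> [r _|eps eps0].
  apply: le_lt_trans (_ : (1%:E * Hs_norm s z < +oo)%E); last by rewrite mul1e.
  apply: Hs_norm_dominated => // k.
  rewrite !ComplexField.Normc.normcM normc_cis mulr1 mul1r -[leRHS]mulr1.
  by rewrite ler_wpM2l//= expr0n add0r sqrtr_sqr.
(* The added 1s keep the denominators positive when b = a or N = 0, and make the final inequality
   strict. *)
pose d := eps / (2 * (b - a + 1) * (N + 1)).
have ba0 : 0 <= b - a by rewrite subr_ge0.
have d0 : 0 < d by rewrite divr_gt0// !mulr_gt0//; lra.
exists d => // n p tau p0 pn ptau.
have mono j : (j < n)%N -> p j <= p j.+1.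
  by move=> /ptau[/andP[h1 h2] _]; exact: le_trans h1 h2.
have tele (V : zmodType) (f : R -> V) :
    \sum_(j < n) (f (p j.+1) - f (p j)) = f b - f a.
  rewrite -p0 -pn; elim: n {p0 pn ptau mono} => [|n IH].
    by rewrite big_ord0 subrr.
  by rewrite big_ord_recr/= IH addrC addrA subrK.
apply: (@le_lt_trans _ _ ((2 * d * (b - a))%:E * Hs_norm s z)%E).
  apply: Hs_norm_dominated; first by rewrite mulr_ge0// mulr_ge0// ltW.
  move=> k; rewrite -(tele _ (fun x => cis (lam k * (x - t)))) mulr_sumr -sumrB.
  rewrite (le_trans (le_normc_sum n (fun j => (real_complex R) (p j.+1 - p j) *
    (z k * ((0 +i* lam k)%C * cis (lam k * (tau j - t)))) -
    z k * (cis (lam k * (p j.+1 - t)) - cis (lam k * (p j - t))))))//.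
  (* The length b - a is itself telescoped, so the comparison can be made interval by interval. *)
  rewrite -(tele _ idfun) /= mulr_sumr mulr_suml; apply: ler_sum => j _.
  have [ptj dj] := ptau j (ltn_ord j).
  rewrite [X in normc X](_ : _ = z k * ((real_complex R) (p j.+1 - p j) *
     ((0 +i* lam k)%C * cis (lam k * (tau j - t))) -
     (cis (lam k * (p j.+1 - t)) - cis (lam k * (p j - t))))); last first.
    by rewrite [RHS]mulrBr [X in X - _]mulrCA.
  rewrite ComplexField.Normc.normcM mulrC ler_wpM2r//.
  rewrite (le_trans (cis_rectangle_error _ _ ptj))// -mulrA ler_wpM2l//.
  by rewrite expr2; apply: ler_wpM2r; [rewrite subr_ge0 mono | exact: ltW].
rewrite zf -EFinM lte_fin /d.
rewrite (_ : _ * N = eps * ((b - a) / (b - a + 1) * (N / (N + 1)))); last first.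
  by field; apply/andP; split; apply: lt0r_neq0; lra.
rewrite -[ltRHS]mulr1 ltr_pM2l// (@le_lt_trans _ _ (1 * (N / (N + 1))))//.
  rewrite ler_wpM2r//; first by rewrite divr_ge0//; lra.
  rewrite ler_pdivrMr; lra.
rewrite mul1r ltr_pdivrMr; lra.
Qed.

Lemma bbm_symbol_le1 (k : int) : `|k%:~R / (1 + k%:~R ^+ 2) : R| <= 1.
Proof.
set x : R := k%:~R; have x2 : 0 < 1 + x ^+ 2 by rewrite ltr_pwDl ?sqr_ge0.
rewrite normrM normfV (gtr0_norm x2) ler_pdivrMr// mul1r.
rewrite -[x ^+ 2]real_normK ?num_real//; nra.
Qed.

Lemma stationary_duhamel s (f : R -> R) : in_Hs s f ->
  (forall k, fourier (fun x => f x ^+ 2) k = - 2%:R * fourier f k) ->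
  duhamel_solution s (fun=> f).
Proof.
move=> fHs f2; split=> // t.
pose lam k : R := k%:~R / (1 + k%:~R ^+ 2).
pose z : @coeffs R := fun k => - 2%:R * fourier f k.
have zoo : (Hs_norm s z < +oo)%E.
  have [_ foo] := fHs.
  apply: le_lt_trans (_ : (2%:E * Hs_norm s (fourier f) < +oo)%E).
    apply: Hs_norm_dominated => // k.
    by rewrite ComplexField.Normc.normcM normcN normcMn ComplexField.Normc.normc1.
  by rewrite lte_mul_pinfty.
have FE : (fun r => bbm_group (t - r)
     (inv_1_sub_dxx (d_x (fourier (fun x => f x ^+ 2))))) =
   (fun r k => z k * ((0 +i* lam k)%C * cis (lam k * (r - t)))).
  apply/funext => r; apply/funext => k.
  rewrite /bbm_group /inv_1_sub_dxx /d_x /multiplier f2 -/(z k).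
  rewrite (_ : - (k%:~R * (t - r) / (1 + k%:~R ^+ 2)) = lam k * (r - t)); last first.
    by rewrite /lam; ring.
  have -> : (0 +i* lam k)%C = (real_complex R) (1 + k%:~R ^+ 2)^-1 * (0 +i* k%:~R)%C.
    by apply/eqP; rewrite eq_complex /= /lam; apply/andP; split; apply/eqP; ring.
  by ring.
(* At r = t the exponential is 1, and at r = 0 it is the symbol of S(t). With z = -2 times the
   coefficients of f, the right side of Duhamel collapses to those coefficients. *)
exists (fun k => z k * (cis (lam k * (t - t)) - cis (lam k * (0 - t)))).
  rewrite FE /Hs_integral; case: ifPn => [t0|].
    by apply: oscillating_Hs_RInt => // k; exact: bbm_symbol_le1.
  rewrite -ltNge => /ltW t0.
  rewrite (_ : (fun k => - _) = fun k => z k * (cis (lam k * (0 - t)) - cis (lam k * (t - t)))).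
    by apply: oscillating_Hs_RInt => // k; exact: bbm_symbol_le1.
  by apply/funext => k; rewrite -mulrN opprB.
move=> k; rewrite /bbm_group /multiplier.
rewrite (_ : - (k%:~R * t / (1 + k%:~R ^+ 2)) = lam k * (0 - t)); last first.
  by rewrite /lam; ring.
rewrite subrr mulr0 /z.
have -> : cis 0 = 1 :> R[i] by rewrite /cis cos0 sin0.
have : (2%:R : R[i]) != 0 by rewrite pnatr_eq0.
by move=> ?; field.
Qed.

End Duhamel.

(** * Stationary solutions in the sense of distributions *)

Section Distributional.
Context {R : realType}.
Notation mu := (@lebesgue_measure R).
Notation twopi := (@twopi R).

Lemma continuous_pairl (f : R * R -> R) (t : R) :
  continuous f -> continuous (fun x => f (t, x)).
Proof.
move=> cf x; have h : (fun y : R => (t, y)) y @[y --> x] --> (t, x).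
  exact: (@cvg_pair R R R (nbhs x) (nbhs t) (nbhs x) _ _ _ _ _ (cvg_cst t) cvg_id).
exact: cvg_comp h (cf (t, x)).
Qed.

Lemma continuous_pairr (f : R * R -> R) (x : R) :
  continuous f -> continuous (fun t => f (t, x)).
Proof.
move=> cf t; have h : (fun s : R => (s, x)) s @[s --> t] --> (t, x).
  exact: (@cvg_pair R R R (nbhs t) (nbhs t) (nbhs x) _ _ _ _ _ cvg_id (cvg_cst x)).
exact: cvg_comp h (cf (t, x)).
Qed.

(* [f] is the pointwise limit of its restrictions to the grids [t \in Z / n]. *)
Lemma continuous2_measurable (f : R * R -> R) :
  continuous f -> measurable_fun [set: R * R] f.
Proof.
move=> cf.
pose q n (t : R) : R := (Num.floor (t * n.+1%:R))%:~R / n.+1%:R.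
pose h n (z : R * R) := f (q n z.1, z.2).
apply: (@measurable_fun_cvg _ _ _ _ h) => [n|[t x] _].
- move=> _ Y mY; rewrite setTI.
  pose cell k : set R := [set` `[k%:~R / n.+1%:R, (k + 1)%:~R / n.+1%:R[].
  rewrite (_ : h n @^-1` Y = \bigcup_(k in [set: int])
      (cell k `*` ((fun x => f (k%:~R / n.+1%:R, x)) @^-1` Y))).
    apply: countable_bigcupT_measurable => // k.
    apply: measurableX; first exact: measurable_itv.
    rewrite -[X in measurable X]setTI.
    suff : measurable_fun setT (fun x => f (k%:~R / n.+1%:R, x)) by exact.
    by apply: continuous_measurable_fun; exact: continuous_pairl.
  have cellP k t : cell k t <-> Num.floor (t * n.+1%:R) = k.
    rewrite /cell/= in_itv/= ler_pdivrMr ?ltr0n// ltr_pdivlMr ?ltr0n//.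
    split=> [h1|<-]; last exact: floor_itv.
    exact: floor_def.
  apply/seteqP; split=> -[t x]; rewrite /h /q /=.
    by move=> Ytx; exists (Num.floor (t * n.+1%:R)) => //; split=> //=; exact/cellP.
  by move=> [k _ [/= /cellP ->]].
- suff qt : q n t @[n --> \oo] --> t.
    have hq : (fun n => (q n t, x)) n @[n --> \oo] --> (t, x).
      exact: (@cvg_pair nat R R \oo (nbhs t) (nbhs x) _ _ _ _ _ qt (cvg_cst x)).
    exact: cvg_comp hq (cf (t, x)).
  apply/cvgrPdist_le => e e0; near=> n.
  have n0 : 0 < n.+1%:R :> R by rewrite ltr0n.
  have /andP[h1 h2] := floor_itv (t * n.+1%:R).
  have tE : t = t * n.+1%:R / n.+1%:R by rewrite mulfK// gt_eqF.
  rewrite [X in X - _]tE -mulrBl normrM ger0_norm ?subr_ge0//.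
  rewrite ger0_norm ?invr_ge0 ?(ltW n0)//.
  apply: (@le_trans _ _ (1 / n.+1%:R)).
    rewrite ler_pM2r ?invr_gt0//; move: h2; rewrite intrD; lra.
  rewrite mul1r invf_ple ?posrE//.
  apply: (@le_trans _ _ n%:R); last by rewrite ler_nat.
  by near: n; exact: nbhs_infty_ger.
Unshelve. all: by end_near. Qed.

Lemma continuous2_section1 (f : R -> R -> R) (x : R) :
  continuous (fun z : R * R => f z.1 z.2) -> continuous (f ^~ x).
Proof.
exact: continuous_pairr.
Qed.

Lemma continuous2_bounded_box (f : R -> R -> R) (a b c d : R) :
  continuous (fun z : R * R => f z.1 z.2) ->
  exists2 M : R, 0 <= M & forall t x, a <= t <= b -> c <= x <= d -> `|f t x| <= M.
Proof.
move=> cf.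
have cK : compact ([set` `[a, b]] `*` [set` `[c, d]] : set (R * R)).
  by apply: compact_setX; exact: segment_compact.
have /compact_bounded[M [_ HM]] := continuous_compact (continuous_subspaceT cf) cK.
exists (`|M| + 1); first by rewrite addr_ge0.
move=> t x tab xcd; apply: (HM (`|M| + 1)).
  by rewrite (le_lt_trans (ler_norm M))// ltrDl.
by exists (t, x) => //; split; rewrite /= in_itv.
Qed.

(** Differentiation under the integral sign, dominated by a bound of the derivative on a compact box
    around x. *)
Lemma integral_partial_x_eq0 (psi : R -> R -> R) (B : R) :
  continuous (fun z : R * R => psi z.1 z.2) ->
  continuous (fun z : R * R => partial_x psi z.1 z.2) ->
  (forall t x, derivable (psi t) x 1) ->
  (forall x, \int[mu]_(t in [set` `[- B, B]]) psi t x = 0) ->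
  forall x, \int[mu]_(t in [set` `[- B, B]]) partial_x psi t x = 0.
Proof.
move=> cpsi cdpsi dpsi psi0 x.
have [M M0 HM] := @continuous2_bounded_box _ (- B) B (x - 1) (x + 1) cdpsi.
have := @differentiation_under_integral R _ _ mu (fun x t => psi t x)
  [set` `[- B, B]] (measurable_itv _) x (x - 1) (x + 1) _ _ _ (cst M) _ _ _.
rewrite /partial1of2 => <-.
- by rewrite (_ : (fun x' => _) = cst 0) ?derive1_cst//; apply/funext.
- by rewrite /= in_itv/= ltrDl gtrBl ltr01.
- by move=> y _; apply: continuous_segment_integrable; exact: continuous2_section1.
- by move=> y t _ _; exact: dpsi.
- by [].
- by apply: continuous_segment_integrable => ?; exact: cvg_cst.
- move=> y t; rewrite /= !in_itv/= => /andP[y1 y2] tB.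
  by apply: HM => //; rewrite !ltW.
Qed.

(** The region |t| > A is open and contains whole lines in x, so both partial derivatives preserve
    vanishing there. *)
Lemma iter_partial_support (phi : R -> R -> R) (A : R) :
  (forall t x, A < `|t| -> phi t x = 0) ->
  forall w t x, A < `|t| -> iter_partial w phi t x = 0.
Proof.
move=> phi0; elim=> [|[] w IH] //= t x At.
  rewrite /partial_t derive1E (@near_eq_derive _ _ _ _ (cst 0)) ?derive_cst//.
  have : \forall s \near t, A < `|s|.
    exact: (cvgr_gt `|t| (cvg_norm (@cvg_id _ (nbhs t))) _ At).
  by apply: filterS => s As; exact: IH.
rewrite /partial_x (_ : iter_partial w phi t = cst 0) ?derive1_cst//.
by apply/funext => y; exact: IH.
Qed.

Lemma integral_partial_t_eq0 (phi : R -> R -> R) (A B : R) : A < B -> 0 < B ->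
  smooth phi -> (forall t x, A < `|t| -> phi t x = 0) ->
  forall x, \int[mu]_(t in [set` `[- B, B]]) partial_t phi t x = 0.
Proof.
move=> AB B0 sm phi0 x.
have dphi t : derivable (phi ^~ x) t 1 by have [/(_ t x)[]] := sm [::].
have [_ cdphi] := sm [:: true].
have cphi : continuous (phi ^~ x).
  by move=> t; apply/differentiable_continuous/derivable1_diffP; exact: dphi.
rewrite /Rintegral (@continuous_FTC2 _ (partial_t phi ^~ x) (phi ^~ x)).
- rewrite !phi0 ?subee//; rewrite ?normrN gtr0_norm//.
- by rewrite gtrN.
- by apply: continuous_subspaceT; exact: continuous2_section1.
- split; first by move=> t _; exact: dphi.
  + by apply: cvg_at_right_filter; exact: cphi.
  + by apply: cvg_at_left_filter; exact: cphi.
- by move=> t _.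
Qed.

Definition box (A : R) : set (R * R) := [set` `[- A, A]] `*` (@period_cell R).

Lemma measurable_box (A : R) : measurable (box A).
Proof. by apply: measurableX; [exact: measurable_itv | exact: measurable_period_cell]. Qed.

Lemma box_lty (A : R) : ((mu \x mu)%E (box A) < +oo)%E.
Proof.
rewrite product_measure1E; last 2 first.
- exact: measurable_itv.
- exact: measurable_period_cell.
apply: lte_mul_pinfty; [exact: measure_ge0 | | exact: period_cell_lty].
rewrite ge0_fin_numE ?measure_ge0//= lebesgue_measure_itv/=.
by case: ifP => _; rewrite ?ltry// -?EFinB ?ltry.
Qed.

Lemma bounded_integrable_box (A M : R) (f : R * R -> R) :
  measurable_fun [set: R * R] f ->
  (forall z, box A z -> `|f z| <= M) ->
  (mu \x mu)%E.-integrable (box A) (EFin \o f).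
Proof.
move=> mf fM; apply: measurable_bounded_integrable.
- exact: measurable_box.
- exact: box_lty.
- exact: measurable_funS mf.
- exists M; split; first exact: num_real.
  by move=> N MN z Dz /=; exact: le_trans (fM z Dz) (ltW MN).
Qed.

Lemma integral_profile_time_eq0 (f : R -> R) (K : R) (V : R -> R -> R) (A B : R) :
  measurable_fun setT f -> (forall x, `|f x| <= K) ->
  continuous (fun z : R * R => V z.1 z.2) ->
  A < B -> (forall t x, A < `|t| -> V t x = 0) ->
  (forall x, \int[mu]_(t in [set` `[- B, B]]) V t x = 0) ->
  \int[(mu \x mu)%E]_(z in setT `*` period_cell) (f z.2 * V z.1 z.2) = 0.
Proof.
move=> mf fK cV AB V0 iV.
have K0 : 0 <= K by rewrite (le_trans _ (fK 0)).
pose g (z : R * R) := f z.2 * V z.1 z.2.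
have mg : measurable_fun [set: R * R] g.
  apply: measurable_funM; last exact: continuous2_measurable cV.
  exact: measurableT_comp mf measurable_snd.
have [M M0 HM] := @continuous2_bounded_box V (- B) B 0 twopi cV.
have VB t x : ~ (- B <= t <= B) -> V t x = 0.
  move=> nt; apply: V0; rewrite ltNge; apply/negP => tA; apply: nt.
  by rewrite -ler_norml (le_trans tA)// ltW.
(* The time support of [V] replaces the infinite strip by a box of finite measure. *)
have gE : (EFin \o g) \_ (setT `*` period_cell) =
          (EFin \o g) \_ (box B).
  apply/funext => -[t x]; rewrite !patchE.
  have [xc|xc] := pselect (period_cell x); last first.
    by rewrite !memNset// => -[].
  rewrite mem_set//; case: ifPn => // /negP; rewrite inE => nt.
  rewrite /g /= VB ?mulr0// => tB; apply: nt; split=> //=.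
have igB : (mu \x mu)%E.-integrable (box B) (EFin \o g).
  apply: (@bounded_integrable_box _ (K * M)) => // -[t x] [/= tB xc].
  by rewrite normrM ler_pM// HM.
have ig : (mu \x mu)%E.-integrable setT ((EFin \o g) \_ (setT `*` period_cell)).
  rewrite gE.
  exact: (integrable_mkcond (mu := (mu \x mu)%E) (EFin \o g) (measurable_box B)).1.
(* Fubini with time as the inner variable: at fixed x the profile is a constant factor. *)
rewrite /Rintegral integral_mkcond -(integral21_prod_meas1 ig).
rewrite (_ : fubini_G _ _ = cst 0%E); first by rewrite integral_cst// mul0e.
apply/funext => x; rewrite /fubini_G /=.
pose c := f x * \1_(@period_cell R) x.
transitivity (\int[mu]_(t in [set` `[(- B)%R, B]]) (c%:E * (V t x)%:E))%E.
  rewrite [RHS]integral_mkcond; apply: eq_integral => t _.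
  rewrite gE !patchE /c indicE.
  case: ifPn => [/set_mem[/= tB xc]|/negP].
    by rewrite !mem_set// mulr1 -EFinM.
  rewrite inE => nB; case: ifPn => // /set_mem tB.
  by rewrite memNset ?mulr0 ?mul0e// => xc; apply: nB.
have iVx : mu.-integrable [set` `[- B, B]] (EFin \o V ^~ x).
  by apply: continuous_segment_integrable; exact: continuous2_section1.
rewrite integralZl//.
have := iV x; rewrite /Rintegral => h.
rewrite -[X in (_ * X)%E]fineK; first by rewrite h mule0.
exact: integrable_fin_num.
Qed.

Lemma stationary_distributional (f : R -> R) (K : R) :
  periodic f twopi -> measurable_fun setT f -> (forall x, `|f x| <= K) ->
  (forall x, f x + f x ^+ 2 / 2%:R = 0) ->
  distributional_solution (fun=> f).
Proof.
move=> pf mf fK f0; split=> // [|A|phi [sm _ [A phi0]] v].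
- exact: measurableT_comp mf measurable_snd.
- apply: (@bounded_integrable_box A (K ^+ 2) (fun z => f z.2 ^+ 2)).
    by apply: measurable_funX; exact: measurableT_comp mf measurable_snd.
  by move=> z _; rewrite normrX lerXn2r ?nnegrE// (le_trans _ (fK 0)).
pose B := `|A| + 1.
have AB : A < B by rewrite (le_lt_trans (ler_norm A))// ltrDl.
have B0 : 0 < B by rewrite ltr_wpDl.
(* Words act with their head outermost: [[:: false; true]] is the x-derivative of phi_t. *)
have cv : continuous (fun z : R * R => v z.1 z.2) by have [_] := sm [:: true].
have cv1 : continuous (fun z : R * R => partial_x v z.1 z.2).
  by have [_] := sm [:: false; true].
have cv2 : continuous (fun z : R * R => partial_x (partial_x v) z.1 z.2).
  by have [_] := sm [:: false; false; true].
have dv t x : derivable (v t) x 1 by have [/(_ t x)[_]] := sm [:: true].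
have dv1 t x : derivable (partial_x v t) x 1.
  by have [/(_ t x)[_]] := sm [:: false; true].
pose V t x := v t x - partial_x (partial_x v) t x.
under eq_Rintegral do rewrite f0 mul0r addr0.
have supp := iter_partial_support phi0.
(* The time integral of v is 0 for every x; differentiating this identity twice in x handles v_xx
   without exchanging mixed derivatives. *)
have i0 := integral_partial_t_eq0 AB B0 sm phi0.
have i1 := integral_partial_x_eq0 cv cv1 dv i0.
have i2 := integral_partial_x_eq0 cv1 cv2 dv1 i1.
apply: (@integral_profile_time_eq0 f K V A B) => //.
- by move=> z; apply: cvgB; [exact: cv | exact: cv2].
- move=> t x At; rewrite /V /v.
  have s1 := supp [:: true] t x At.
  have s2 := supp [:: false; false; true] t x At.
  by rewrite /= in s1 s2; rewrite s1 s2 subr0.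
- move=> x; rewrite /V RintegralB//.
  + by rewrite i0 i2 subr0.
  + by apply: continuous_segment_integrable; exact: continuous2_section1.
  + by apply: continuous_segment_integrable; exact: continuous2_section1 cv2.
Qed.

End Distributional.

(** * Assembly for arcs, and short arcs of small norm *)

Section Consequence.
Context {R : realType}.
Notation mu := (@lebesgue_measure R).
Notation twopi := (@twopi R).

Lemma arc_profile_in_Hs (s : R) (E : set R) : 0 <= s < 2^-1 ->
  is_arc E -> 0 < torus_measure E -> in_Hs s (arc_profile E).
Proof.
move=> s01 aE E0; split; first exact: arc_profile_L2.
have [C _ hC] := Hs_norm2_arc_profile_le s01.
by rewrite Hs_norm_lty (le_lt_trans (hC _ aE E0))// ltry.
Qed.

Lemma fourier_arc_profile_sqr (E : set R) k : is_arc E ->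
  fourier (fun x => arc_profile E x ^+ 2) k = - 2%:R * fourier (arc_profile E) k.
Proof.
move=> aE.
have scal (g : R -> R) : continuous g -> (forall x, `|g x| <= 1) ->
    \int[mu]_(x in period_cell) (arc_profile E x ^+ 2 * g x) =
    - 2 * \int[mu]_(x in period_cell) (arc_profile E x * g x).
  move=> cg g1; rewrite -RintegralZl; first last.
  - apply: (@bounded_integrable_cell R (fun x => arc_profile E x * g x) 2).
      apply: measurable_funM; first exact: measurable_arc_profile.
      exact: continuous_measurable_fun.
    move=> x; rewrite normrM -[leRHS]mulr1.
    by rewrite ler_pM// arc_profile_norm_le.
  - exact: measurable_period_cell.
  by apply: eq_Rintegral => x _; rewrite arc_profile_sqr mulrA.
rewrite /fourier !scal.
- apply/eqP; rewrite eq_complex /=; apply/andP; split; apply/eqP; ring.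
- exact: sinM_continuous.
- by move=> x; exact: sin_max.
- exact: cosM_continuous.
- by move=> x; exact: cos_max.
Qed.

Lemma arc_profile_duhamel (s : R) (E : set R) : 0 <= s < 2^-1 ->
  is_arc E -> 0 < torus_measure E -> duhamel_solution s (fun=> arc_profile E).
Proof.
move=> s01 aE E0; apply: stationary_duhamel; first exact: arc_profile_in_Hs.
by move=> k; exact: fourier_arc_profile_sqr.
Qed.

Lemma arc_profile_distributional (E : set R) : is_arc E ->
  distributional_solution (fun=> arc_profile E).
Proof.
move=> aE; apply: (@stationary_distributional R _ 2).
- exact: periodic_arc_profile.
- exact: measurable_arc_profile.
- exact: arc_profile_norm_le.
- exact: arc_profile_root.
Qed.

Lemma Hs_norm_zero (s : R) : Hs_norm s (fourier (fun=> 0 : R)) = 0%E.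
Proof.
rewrite /Hs_norm /Hs_norm2 esum1 ?sqrte0// => k _.
rewrite (_ : fourier _ k = 0) ?ComplexField.Normc.normc0 ?expr0n ?mulr0//.
have z (g : R -> R) : \int[mu]_(x in period_cell) (0 * g x) = 0 :> R.
  by under eq_Rintegral do rewrite mul0r; rewrite Rintegral_cst ?mul0r//;
    exact: measurable_period_cell.
by rewrite /fourier !z mulr0 oppr0.
Qed.

Lemma constant_in_C_Hs (s : R) (f : R -> R) : in_Hs s f -> in_C_Hs s (fun=> f).
Proof.
move=> fHs; split=> // t0; under eq_fun do under eq_fun do rewrite subrr.
by rewrite Hs_norm_zero; exact: cvg_cst.
Qed.

Definition small_arc (L : R) : set R :=
  [set x | exists k : int, x + k%:~R * twopi \in `[0, L]].

Lemma small_arcP (L x : R) : L < twopi -> 0 <= x < twopi ->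
  small_arc L x <-> 0 <= x <= L.
Proof.
have T0 := @twopi_gt0 R => LT /andP[x0 xT]; split=> [[k]|xL]; last first.
  by exists 0; rewrite mul0r addr0 in_itv.
rewrite in_itv/= => /andP[h1 h2].
have k0 : 0 <= k by apply: (@int_mulr_gtN R k twopi T0); lra.
have : (k < 1)%R by rewrite -(ltr_int R) -(ltr_pM2r T0) mul1r; lra.
case: k k0 h1 h2 => [[|//]|//] _ h1 h2 _; rewrite mul0r addr0 in h1 h2.
by rewrite h1.
Qed.

Lemma torus_measure_small_arc (L : R) : 0 < L < twopi ->
  torus_measure (small_arc L) = L.
Proof.
move=> /andP[L0 LT]; rewrite /torus_measure.
rewrite (_ : _ `&` _ = [set` `[0, L]]).
  by rewrite lebesgue_measure_itv/= lte_fin L0 oppr0 adde0.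
apply/seteqP; split=> x /=.
  by move=> [sx]; rewrite !in_itv/= => xT; exact/small_arcP.
rewrite !in_itv/= => xL; have xT : 0 <= x < twopi.
  by have /andP[-> /le_lt_trans ->] := xL.
by split=> //; exact/small_arcP.
Qed.

Lemma admissible_small_arc (L : R) : 0 < L < twopi -> admissible_arc (small_arc L).
Proof.
move=> LT; have /andP[L0 LT'] := LT; split.
- by exists `[0, L].
- by rewrite torus_measure_small_arc.
exists ((L + twopi) / 2).
apply: (@filterS _ _ _ [set` `]L, twopi[]); last first.
  by apply: near_in_itvoo; rewrite in_itv/=; apply/andP; split; lra.
move=> x /=; rewrite in_itv/= => /andP[Lx xT] /small_arcP h.
have x0T : 0 <= x < twopi by rewrite xT ltW// (lt_trans L0).
by have /andP[_] := h LT' x0T; rewrite leNgt Lx.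
Qed.

(** The minimum with 1 keeps L below 2pi; the other argument gives L^sg <= b, and C b < e because
    C/(C+1) <= 1. *)
Lemma exists_small_length (C sg e : R) : 0 <= C -> 0 < sg -> 0 < e ->
  exists2 L : R, 0 < L < twopi & C * L `^ sg < e.
Proof.
move=> C0 sg0 e0; pose b := e / (2 * (C + 1)).
have C1 : 0 < C + 1 by rewrite ltr_wpDl.
have b0 : 0 < b by rewrite divr_gt0// mulr_gt0.
exists (Num.min 1 (b `^ sg^-1)).
  rewrite lt_min ltr01 powR_gt0//= gt_min; apply/orP; left.
  by rewrite /Defs.twopi; have := @pi_ge2 R; lra.
apply: (@le_lt_trans _ _ (C * b)).
  rewrite ler_wpM2l// -[leRHS](powRr1 (ltW b0)).
  rewrite [leRHS](_ : _ = (b `^ sg^-1) `^ sg); last first.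
    by rewrite -powRrM mulVf// lt0r_neq0.
  apply: ge0_ler_powR; rewrite ?nnegrE ?powR_ge0 ?(ltW sg0)//.
    by rewrite le_min ler01 powR_ge0.
  by rewrite ge_min lexx orbT.
have -> : C * b = e * (C / (C + 1)) / 2.
  by rewrite /b; field; rewrite gt_eqF.
have h : C / (C + 1) <= 1 by rewrite ler_pdivrMr//; lra.
have : e * (C / (C + 1)) <= e by rewrite ger_pMr.
lra.
Qed.

End Consequence.


Theorem mainTheorem10 (R : realType) :
  [/\ (* (i) *)
      forall E : set R, admissible_arc E ->
        let uE : R -> R -> R := fun t x => arc_profile E x in
        [/\ {ae @lebesgue_measure R,
              forall x, arc_profile E x + arc_profile E x ^+ 2 / 2%:R = 0},
            distributional_solution uE,
            nonzero (arc_profile E),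
            exists w : set R,
              [/\ torus_open w, w !=set0 & vanishes_on w uE]
          & duhamel_solution 0 uE],
      (* (ii) *)
      forall s : R, 0 <= s < 2%:R^-1 ->
        (forall E : set R, admissible_arc E -> in_Hs s (arc_profile E)) /\
        exists C : R, forall E : set R, admissible_arc E ->
          (Hs_norm2 s (fourier (arc_profile E))
             <= (C * torus_measure E `^ (1 - 2%:R * s))%:E)%E
    & (* consequence *)
      forall s delta : R, 0 <= s < 2%:R^-1 -> 0 < delta ->
        exists (u : R -> R -> R) (w : set R),
          [/\ in_C_Hs s u,
              distributional_solution u /\ duhamel_solution s u,
              (Hs_norm s (fourier (u 0%R)) < delta%:E)%E,
              [/\ torus_open w, w !=set0 & vanishes_on w u]
            & exists t, nonzero (u t)]].
Proof.
split.
- move=> E [aE E0 EC] uE; split.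
  + by apply: aeW => x; exact: arc_profile_root.
  + exact: arc_profile_distributional.
  + exact: arc_profile_nonzero.
  + exists (~` E)°; split=> //; first exact: torus_open_arcC.
    exact: arc_profile_vanishes.
  + by apply: arc_profile_duhamel => //; rewrite lexx invr_gt0 ltr0n.
- move=> s s01; split; first by move=> E [aE E0 _]; exact: arc_profile_in_Hs.
  have [C _ hC] := Hs_norm2_arc_profile_le s01.
  by exists C => E [aE E0 _]; exact: hC.
- move=> s delta s01 delta0.
  have [C C0 hC] := Hs_norm2_arc_profile_le s01.
  have sg0 : 0 < 1 - 2 * s by have /andP[_ ?] := s01; lra.
  (* The target is delta^2, since the Sobolev bound concerns the squared norm. *)
  have [L LT hL] := exists_small_length C0 sg0 (exprn_gt0 2 delta0).
  have [aE E0 EC] := admissible_small_arc LT.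
  have EL := torus_measure_small_arc LT.
  set E := small_arc L in aE E0 EC EL.
  exists (fun=> arc_profile E), (~` E)°; split.
  + by apply: constant_in_C_Hs; exact: arc_profile_in_Hs.
  + by split; [exact: arc_profile_distributional | exact: arc_profile_duhamel].
  + rewrite -(ger0_norm (ltW delta0)) -sqrtr_sqr.
    rewrite (le_lt_trans (y := sqrte (C * L `^ (1 - 2 * s))%:E))//.
      by rewrite /Hs_norm lee_sqrt ?lee_fin ?mulr_ge0 ?powR_ge0// -EL; exact: hC.
    by rewrite /= lte_fin ltr_sqrt// exprn_gt0.
  + split=> //; first exact: torus_open_arcC.
    exact: arc_profile_vanishes.
  + by exists 0; exact: arc_profile_nonzero.
Qed.
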